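(* Let $\{\mathcal{G}_n\}_{n\ge0}$ be the uniform random tree sequence, i.e. the tree sequence ($m_i=1$ for all $i\ge1$) with attachment function $f(k)=1$ for all $k\in\mathbb{N}_0$. Then $$\frac{\log\mathcal{I}^*_n}{\log n}\xrightarrow{P}1-\frac{1}{2\ln2}\quad\text{as }n\to\infty,$$ $$\frac{d_{max}(n)}{\log n}\xrightarrow{P}\frac{1}{\ln2}\quad\text{as }n\to\infty.$$
   Context: $\mathcal{G}_0$ consists of one vertex $v_0$ and no edges. Given $\mathcal{G}_{n-1}$ (with vertices $v_0,\dots,v_{n-1}$), $\mathcal{G}_n$ is obtained by adding one vertex $v_n$ and one edge directed from $v_n$ to a vertex chosen uniformly at random among $v_0,\dots,v_{n-1}$ (this is attachment with probability proportional to $f(\text{degree})$ with $f\equiv1$). Degree means in-degree plus out-degree; $d_i(n)$ is the degree of $v_i$ in $\mathcal{G}_n$; $d_{max}(n)=\max_{0\le i\le n}d_i(n)$; and $\mathcal{I}^*_n=\inf\{0\le i\le n: d_i(n)\ge d_j(n)\text{ for all }j\le n\}$ is the index of the oldest vertex of maximal degree. ($\log 0=-\infty$; $\log=\ln$ is the natural logarithm.) *)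

(* Defs.v *)
From HB Require Import structures.
From mathcomp Require Export all_boot all_order all_algebra.
From mathcomp Require Export all_classical all_reals all_analysis.
Export Order.TTheory GRing.Theory Num.Theory.
Export numFieldNormedType.Exports.

Set Implicit Arguments.
Unset Strict Implicit.
Unset Printing Implicit Defensive.

Local Open Scope classical_set_scope.
Local Open Scope ring_scope.

(* A finite directed (multi)graph on vertices v_0, v_1, ..., given by the list
   of its edges in order of creation; (i, j) is an edge from v_i to v_j. *)
Definition digraph := seq (nat * nat).

Definition degree (g : digraph) (i : nat) : nat :=
  (count (fun e => e.2 == i) g + count (fun e => e.1 == i) g)%N.

Definition max_degree (n : nat) (g : digraph) : nat :=
  (\max_(i < n.+1) degree g i)%N.

(* The position found in iota 0 n.+1 = [:: 0; ...; n] is the element itself,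
   so this is the least i <= n of maximal degree among v_0, ..., v_n. *)
Definition oldest_max_index (n : nat) (g : digraph) : nat :=
  find (fun i => all (fun j => (degree g j <= degree g i)%N) (iota 0 n.+1))
       (iota 0 n.+1).

(* Law of the tree sequence (one new edge per step) with attachment function f:
   given G_n, which records the whole history, the new vertex v_{n+1} sends its
   edge to v_j, j <= n, with probability proportional to f (degree of v_j). *)
Record attachment_tree d (T : measurableType d) (R : realType)
    (P : probability T R) (f : nat -> R) (G : nat -> T -> digraph) : Prop :=
  AttachmentTree {
    attachment_tree_measurable :
      forall n g, measurable [set w | G n w = g] ;
    attachment_tree_init :
      forall w, G 0%N w = [::] ;
    attachment_tree_grow :
      forall n w, exists2 j, (j <= n)%N & G n.+1 w = rcons (G n w) (n.+1, j) ;
    attachment_tree_step :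
      forall n g j, (j <= n)%N ->
        (P [set w | G n w = g /\ G n.+1 w = rcons g (n.+1, j)]
         = P [set w | G n w = g] *
           (f (degree g j) / \sum_(i < n.+1) f (degree g i))%:E)%E }.

Definition uniform_random_tree d (T : measurableType d) (R : realType)
    (P : probability T R) (G : nat -> T -> digraph) : Prop :=
  attachment_tree P (fun=> 1) G.

(* Convergence in probability to a finite constant; extended-real values are
   allowed because log 0 = -oo. *)
Definition cvg_in_probability d (T : measurableType d) (R : realType)
    (P : probability T R) (X : nat -> T -> \bar R) (c : R) : Prop :=
  forall eps : R, 0 < eps ->
    P [set w | (eps%:E < `|X n w - c%:E|)%E] @[n --> \oo] --> 0%E.

(* Main.v *)
Require Import Defs.
From mathcomp Require Import ring lra zify.

(** The law of the tree with n edges is uniform on the n! recursive trees, so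
    every probability below is an average over a finite list of trees. Write
    D_i for the in-degree of v_i at time n; it is a sum of independent
    Bernoulli (1/k) variables, i < k <= n, and the degree exceeds it by at
    most 1. Three estimates give both limits.

    First moment. E z^(D_i) is the product of the 1 + (z - 1)/k, i < k <= n.
    At z = 2 this telescopes to (n + 1)/(i + 1), so that by Markov's inequality
    the expected number of vertices of degree at least a ln n is at most about
    n^(1 - a ln 2): no vertex has degree above (1/ln 2 + eps) ln n.

    Second moment. Let a_n(D) be the expected number of vertices of in-degree at
    least D. The choice z = 2 is a change of measure under which the steps
    become Bernoulli (2/(k+1)), and it gives the exact formula
    a_n(D) = (n + 1) 2^(-D) P(S_n >= D) with S_n a sum of independent such
    variables. As S_n is close to 2 ln n, which exceeds ln n / ln 2, the last
    factor is at least 1/2 as soon as 2^D is a small multiple of n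
    ([mean_num_indeg_ge_lb]). The events D_i >= D are pairwise negatively
    correlated ([indeg_tail2_le]), hence the number of such vertices has variance
    at most its mean and vanishes with probability at most 1/a_n(D). So some
    vertex has degree at least (1/ln 2 - delta) ln n.

    Location of the maximum. Perturb the tilt to z = 2 + eta. By
    1 + (1 + eta)/k = (k + 1)/k (1 + eta/(k + 1)), the bound on E z^(D_i) gains
    about (n/i)^eta, which equals n^(eta (1 - x)) for i = n^x, while the Markov
    factor z^(-ln n/ln 2) changes by n^(-eta/(2 ln 2)) to first order. These
    balance exactly at x = 1 - 1/(2 ln 2). For x larger than this take eta > 0,
    for x smaller take eta < 0: in both cases a degree close to ln n / ln 2 is
    excluded at indices away from n^(1 - 1/(2 ln 2))
    ([vanishing_far_index]), and the maximum is known to be that large. *)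

Set Implicit Arguments.
Unset Strict Implicit.
Unset Printing Implicit Defensive.

Local Open Scope classical_set_scope.
Local Open Scope ring_scope.

(** * Averages over recursive trees *)

Fixpoint recursive_trees (n : nat) : seq digraph :=
  if n is m.+1
  then [seq rcons g (m.+1, j) | g <- recursive_trees m, j <- iota 0 m.+1]
  else [:: [::]].

Definition avg (R : realType) (n : nat) (F : digraph -> R) : R :=
  (n`!%:R)^-1 * \sum_(g <- recursive_trees n) F g.

Definition indeg (g : digraph) (i : nat) : nat := count (fun e => e.2 == i) g.

Lemma mem_recursive_treesS (n : nat) (g : digraph) : g \in recursive_trees n.+1 ->
  exists h j, [/\ h \in recursive_trees n, (j <= n)%N & g = rcons h (n.+1, j)].
Proof.
case/allpairsP => -[h j]; rewrite mem_iota /= add0n => -[hh jn ->].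
by exists h, j.
Qed.

Lemma recursive_trees_edges (n : nat) (g : digraph) : g \in recursive_trees n ->
  all (fun e => (0 < e.1 <= n)%N && (e.2 < n)%N) g.
Proof.
elim: n g => [|n IHn] g; first by rewrite inE => /eqP ->.
case/mem_recursive_treesS => h [j [hh jn ->]].
rewrite all_rcons /= leqnn ltnS jn /=; apply: sub_all (IHn _ hh) => e /=; lia.
Qed.

Lemma indeg_new_vertex (n : nat) (g : digraph) (i : nat) :
  g \in recursive_trees n -> (n <= i)%N -> indeg g i = 0%N.
Proof.
move=> /recursive_trees_edges/allP gn ni; apply/eqP.
rewrite -leqn0 leqNgt -has_count.
apply/negP => /hasP[[a b] /gn /= + /eqP]; lia.
Qed.

Lemma outdeg_le1 (n : nat) (g : digraph) (i : nat) :
  g \in recursive_trees n -> (count (fun e => e.1 == i) g <= 1)%N.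
Proof.
elim: n g => [|n IHn] g; first by rewrite inE => /eqP ->.
case/mem_recursive_treesS => h [j [hh jn ->]].
rewrite -cats1 count_cat /= addn0.
case: (eqVneq n.+1 i) => [<-|_] /=; last first.
  by rewrite addn0; exact: IHn.
suff -> : count (fun e : nat * nat => e.1 == n.+1) h = 0%N by [].
apply/eqP; rewrite -leqn0 leqNgt -has_count.
apply/negP => /hasP[[a b] /(allP (recursive_trees_edges hh)) /= + /eqP]; lia.
Qed.

(** Every vertex but the root has out-degree 1, so replacing degrees by
    in-degrees costs at most 1, which is invisible at scale ln n. *)
Lemma degree_bounds (n : nat) (g : digraph) (i : nat) : g \in recursive_trees n ->
  (indeg g i <= degree g i <= (indeg g i).+1)%N.
Proof. by move=> /outdeg_le1 - /(_ i); rewrite /degree /indeg; lia. Qed.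

Lemma indeg_rcons (g : digraph) (a j i : nat) :
  indeg (rcons g (a, j)) i = (indeg g i + (j == i))%N.
Proof. by rewrite /indeg -cats1 count_cat /= addn0. Qed.

Lemma avg0 (R : realType) (F : digraph -> R) : avg 0 F = F [::].
Proof. by rewrite /avg /= big_seq1 invr1 mul1r. Qed.

(** The one-step recursion that drives every computation below: first average
    over the vertex receiving the last edge. *)
Lemma avgS (R : realType) (n : nat) (F : digraph -> R) :
  avg n.+1 F =
  avg n (fun g => n.+1%:R^-1 * \sum_(j < n.+1) F (rcons g (n.+1, val j))).
Proof.
rewrite /avg -mulr_sumr mulrA factS natrM invfM [_^-1 * _^-1]mulrC.
congr (_ * _).
rewrite [recursive_trees n.+1]/(allpairs_dep _ _ _) -/recursive_trees.
rewrite big_allpairs_dep; apply: eq_bigr => g _.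
rewrite -(big_mkord xpredT (fun j => F (rcons g (n.+1, j)))).
by rewrite /index_iota subn0.
Qed.

Lemma eq_avg (R : realType) (n : nat) (F F' : digraph -> R) :
  (forall g, g \in recursive_trees n -> F g = F' g) -> avg n F = avg n F'.
Proof.
by move=> e; rewrite /avg; congr (_ * _); rewrite big_seq [RHS]big_seq;
  exact: eq_bigr.
Qed.

Lemma le_avg (R : realType) (n : nat) (F F' : digraph -> R) :
  (forall g, g \in recursive_trees n -> F g <= F' g) -> avg n F <= avg n F'.
Proof.
move=> e; rewrite /avg ler_wpM2l ?invr_ge0 ?ler0n //.
by rewrite big_seq [leRHS]big_seq; exact: ler_sum.
Qed.

Lemma avg_cst (R : realType) (n : nat) (c : R) : avg n (fun=> c) = c.
Proof.
elim: n => [|n IHn]; first by rewrite avg0.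
rewrite avgS; under eq_avg do
  rewrite sumr_const card_ord -[c *+ _]mulr_natl mulKf ?pnatr_eq0//.
exact: IHn.
Qed.

Lemma avgD (R : realType) (n : nat) (F F' : digraph -> R) :
  avg n (fun g => F g + F' g) = avg n F + avg n F'.
Proof. by rewrite /avg big_split mulrDr. Qed.

Lemma avgZ (R : realType) (n : nat) (c : R) (F : digraph -> R) :
  avg n (fun g => c * F g) = c * avg n F.
Proof. by rewrite /avg -mulr_sumr mulrCA. Qed.

Lemma avgZr (R : realType) (n : nat) (c : R) (F : digraph -> R) :
  avg n (fun g => F g * c) = avg n F * c.
Proof. by rewrite /avg -mulr_suml mulrA. Qed.

Lemma avgB (R : realType) (n : nat) (F F' : digraph -> R) :
  avg n (fun g => F g - F' g) = avg n F - avg n F'.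
Proof. by rewrite /avg sumrB mulrBr. Qed.

Lemma avg_sum (R : realType) (n : nat) (I : Type) (r : seq I) (Q : pred I)
    (F : I -> digraph -> R) :
  avg n (fun g => \sum_(i <- r | Q i) F i g) = \sum_(i <- r | Q i) avg n (F i).
Proof. by rewrite /avg exchange_big mulr_sumr. Qed.

Lemma avg_ge0 (R : realType) (n : nat) (F : digraph -> R) :
  (forall g, 0 <= F g) -> 0 <= avg n F.
Proof. by move=> F0; rewrite -(avg_cst n 0); apply: le_avg. Qed.

Lemma avg_indegS (R : realType) (n i : nat) (f : nat -> R) : (i <= n)%N ->
  avg n.+1 (fun g => f (indeg g i)) =
  avg n (fun g => f (indeg g i)
    + (f (indeg g i).+1 - f (indeg g i)) / n.+1%:R).
Proof.
move=> i_n; rewrite avgS; apply: eq_avg => g _.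
have ni : (i < n.+1)%N by [].
rewrite (bigD1 (Ordinal ni)) //= indeg_rcons eqxx addn1.
rewrite (eq_bigr (fun=> f (indeg g i))) => [|j jni]; last first.
  rewrite indeg_rcons -[X in X == i]/(val j) -[X in _ == X]/(val (Ordinal ni)).
  by rewrite val_eqE (negPf jni) addn0.
rewrite sumr_const cardC1 card_ord /= -[_ *+ n]mulr_natl.
have -> : (n%:R : R) = n.+1%:R - 1 by rewrite -natr1 addrK.
have n0 : n.+1%:R != 0 :> R by rewrite pnatr_eq0.
by field.
Qed.

(** The last edge hits at most one of two distinct vertices, whence there is no
    term in which both in-degrees increase. *)
Lemma avg_indeg2S (R : realType) (n i j : nat) (f h : nat -> R) :
  (i < j <= n)%N ->
  avg n.+1 (fun g => f (indeg g i) * h (indeg g j)) =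
  avg n (fun g => f (indeg g i) * h (indeg g j)
    + ((f (indeg g i).+1 - f (indeg g i)) * h (indeg g j)
       + f (indeg g i) * (h (indeg g j).+1 - h (indeg g j))) / n.+1%:R).
Proof.
move=> /andP[ij jn]; rewrite avgS; apply: eq_avg => g _.
have ni : (i < n.+1)%N by lia.
have nj : (j < n.+1)%N by [].
have dij : Ordinal nj != Ordinal ni by rewrite -val_eqE /=; lia.
rewrite (bigD1 (Ordinal ni)) //= (bigD1 (Ordinal nj)) //=.
rewrite !indeg_rcons !eqxx.
have -> : (i == j) = false by lia.
have -> : (j == i) = false by lia.
rewrite !addn1 !addn0.
rewrite (eq_bigr (fun=> f (indeg g i) * h (indeg g j)))
  => [|k /andP[ki kj]]; last first.
  rewrite !indeg_rcons; move: ki kj; rewrite -!val_eqE /= => /negPf -> /negPf ->.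
  by rewrite !addn0.
rewrite sumr_const.
have -> : #|[pred k : 'I_n.+1 | (k != Ordinal ni) && (k != Ordinal nj)]| = n.-1.
  have := cardD1 (Ordinal ni) [pred k : 'I_n.+1 | true].
  have := cardD1 (Ordinal nj) [pred k : 'I_n.+1 | k != Ordinal ni].
  rewrite !inE dij => e1.
  have -> : #|[pred k : 'I_n.+1 | true]| = n.+1.
    by rewrite -[RHS]card_ord; apply: eq_card.
  have -> : #|[predD1 [pred _ : 'I_n.+1 | true] & Ordinal ni]|
          = #|[pred k : 'I_n.+1 | k != Ordinal ni]|.
    by apply: eq_card => k; rewrite !inE andbT.
  rewrite e1.
  have -> : #|[predD1 [pred k | k != Ordinal ni] & Ordinal nj]|
      = #|[pred k : 'I_n.+1 | (k != Ordinal ni) && (k != Ordinal nj)]|.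
    by apply: eq_card => k; rewrite !inE andbC.
  by move=> /=; lia.
rewrite -[_ *+ n.-1]mulr_natl.
have -> : (n.-1%:R : R) = n.+1%:R - 2.
  by case: n jn {ni nj dij} => [|m _]; [lia|rewrite -!natr1 /=; ring].
have n0 : n.+1%:R != 0 :> R by rewrite pnatr_eq0.
by field.
Qed.

(** * First moment: tilted generating functions *)

(** The factors are the generating functions of the independent Bernoulli (1/k)
    indicators that the edge of v_k points to v_i. *)
Lemma avg_expindeg (R : realType) (z : R) (n i : nat) : (i <= n)%N ->
  avg n (fun g => z ^+ indeg g i) =
  \prod_(i.+1 <= k < n.+1) (1 + (z - 1) / k%:R).
Proof.
elim: n => [|n IHn] i_n.
  move: i_n; rewrite leqn0 => /eqP ->.
  by rewrite avg0 big_geq.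
move: i_n; rewrite leq_eqVlt => /orP[/eqP ->|i_n].
  rewrite big_geq // -[RHS](avg_cst n.+1); apply: eq_avg => g gn.
  by rewrite (indeg_new_vertex gn).
rewrite ltnS in i_n.
rewrite (avg_indegS (fun a => z ^+ a) i_n) big_nat_recr //= -IHn //.
rewrite [RHS]mulrC -avgZ.
by apply: eq_avg => g _; rewrite exprS; ring.
Qed.

Lemma inv_le_lnB (R : realType) (k : nat) : (0 < k)%N ->
  k.+1%:R^-1 <= ln (k.+1%:R : R) - ln k%:R.
Proof.
move=> k0; have k0' : (0 : R) < k%:R by rewrite ltr0n.
have i1 : k.+1%:R^-1 < 1 :> R by rewrite invf_lt1 ?ltr0n // ltr1n.
have := @le_ln1Dx R (- k.+1%:R^-1); rewrite ltrN2 => /(_ i1).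
have -> : 1 - k.+1%:R^-1 = k%:R / k.+1%:R :> R.
  by rewrite -[k.+1%:R]natr1; field; apply/eqP; lra.
rewrite ln_div ?posrE ?ltr0n // => h.
by rewrite lerNr opprB in h.
Qed.

Lemma lnB_le_inv (R : realType) (k : nat) :
  ln (k.+2%:R : R) - ln k.+1%:R <= k.+1%:R^-1.
Proof.
have i0 : 0 < k.+1%:R^-1 :> R by rewrite invr_gt0 ltr0n.
have := @le_ln1Dx R (k.+1%:R^-1).
have -> : -1 < k.+1%:R^-1 :> R by rewrite (lt_trans _ i0) ?ltrN10.
move=> /(_ isT).
have -> : 1 + k.+1%:R^-1 = k.+2%:R / k.+1%:R :> R.
  by have := ler0n R k => k0; rewrite -[k.+2%:R]natr1; field; apply/eqP; lra.
by rewrite ln_div ?posrE ?ltr0n.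
Qed.

(** This difference of harmonic numbers is ln (n/i) up to a constant; keeping it
    as a sum lets the generating function be bounded factor by factor. *)
Definition harmonic_gap (R : realType) (i n : nat) : R :=
  \sum_(i.+1 <= k < n.+1) k.+1%:R^-1.

Lemma harmonic_gap_le (R : realType) (i n : nat) : (i <= n)%N ->
  harmonic_gap R i n <= ln n.+1%:R - ln i.+1%:R.
Proof.
move=> i_n; rewrite -(telescope_sumr (fun k => ln (k%:R : R))) ?ltnS //.
rewrite /harmonic_gap big_nat [leRHS]big_nat; apply: ler_sum => k /andP[ik _].
by apply: inv_le_lnB; lia.
Qed.

Lemma harmonic_gap_ge (R : realType) (i n : nat) : (i <= n)%N ->
  ln n.+2%:R - ln i.+2%:R <= harmonic_gap R i n.
Proof.
move=> i_n; rewrite -(telescope_sumr (fun k => ln (k.+1%:R : R))) ?ltnS //.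
by apply: ler_sum => k _; exact: lnB_le_inv.
Qed.

Lemma sum_inv_le (R : realType) (n : nat) :
  \sum_(i < n.+1) (i.+1%:R^-1 : R) <= 1 + ln n.+1%:R.
Proof.
rewrite -(big_mkord xpredT (fun i => (i.+1%:R^-1 : R))) big_nat_recl //= invr1.
rewrite lerD2l.
have := harmonic_gap_le R (leq0n n); rewrite ln1 subr0; apply: le_trans.
by rewrite /harmonic_gap big_add1.
Qed.

(** Factoring (k + 1)/k out of each term isolates the balanced case eta = 0,
    in which the product telescopes; 1 + x <= exp x bounds the rest for
    either sign of eta. *)
Lemma prod_tilt_le (R : realType) (eta : R) (i n : nat) : -1 <= eta -> (i <= n)%N ->
  \prod_(i.+1 <= k < n.+1) (1 + (1 + eta) / k%:R)
  <= n.+1%:R / i.+1%:R * expR (eta * harmonic_gap R i n).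
Proof.
move=> eta1 i_n; rewrite /harmonic_gap mulr_sumr expR_sum.
have -> : n.+1%:R / i.+1%:R = \prod_(i.+1 <= k < n.+1) (k.+1%:R / k%:R) :> R.
  move: i_n; rewrite leq_eqVlt => /orP[/eqP->|i_n].
    by rewrite big_geq // divff // pnatr_eq0.
  rewrite (telescope_prodf (f := fun k => k%:R : R)) ?ltnS // => k.
  by rewrite pnatr_eq0; lia.
rewrite -big_split /= big_nat [leRHS]big_nat; apply: ler_prod => k /andP[ik _].
have k0 : (0 : R) < k%:R by rewrite ltr0n; lia.
apply/andP; split; first by rewrite addr_ge0 // divr_ge0; lra.
have -> : 1 + (1 + eta) / k%:R = k.+1%:R / k%:R * (1 + eta / k.+1%:R) :> R.
  by rewrite -[k.+1%:R]natr1; field; apply/andP; split; apply/eqP; lra.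
by rewrite ler_wpM2l ?expR_ge1Dx // divr_ge0 ?ler0n.
Qed.

(** Union bound over the vertices in J and Markov's inequality for
    (2 + eta)^degree. The sum over i of (n + 1)/(i + 1) costs the factor
    (n + 1)(1 + ln (n + 1)). *)
Lemma avg_exists_degree_le (R : realType) (eta K y : R) (n : nat) (J : pred nat) :
  -1 <= eta -> (forall i, (i <= n)%N -> J i -> eta * harmonic_gap R i n <= K) ->
  avg n (fun g =>
    [exists i : 'I_n.+1, J i && (y <= (degree g i)%:R)]%:R)
  <= (2 + eta) * expR (K - y * ln (2 + eta)) * (n.+1%:R * (1 + ln n.+1%:R)).
Proof.
move=> eta1 hK; set z := 2 + eta.
have z1 : 1 <= z by rewrite /z; lra.
have z0 : 0 < z by lra.
have lz : 0 <= ln z by exact: ln_ge0.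
apply: (@le_trans _ _ (avg n (fun g =>
  z * expR (- y * ln z) * \sum_(i < n.+1 | J i) z ^+ indeg g i))).
  apply: le_avg => g gn; case: existsP => [[i /andP[Ji yi]]|_]; last first.
    rewrite !mulr_ge0 ?expR_ge0 ?sumr_ge0 // ?(ltW z0) // => i _.
    by rewrite exprn_ge0 // ltW.
  apply: (@le_trans _ _ (z * expR (- y * ln z) * z ^+ indeg g i)).
    rewrite mulrAC -exprS.
    have /andP[_ di] := degree_bounds i gn.
    have -> : z ^+ (indeg g i).+1 = expR ((indeg g i).+1%:R * ln z).
      by rewrite expRM_natl lnK.
    rewrite -expRD -[leLHS]expR0 ler_expR -mulrDl mulr_ge0 //.
    by rewrite subr_ge0 (le_trans yi) // ler_nat.
  rewrite ler_wpM2l ?mulr_ge0 ?expR_ge0 ?(ltW z0) //.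
  rewrite (bigD1 i) //= lerDl sumr_ge0 // => k _.
  by rewrite exprn_ge0 // ltW.
rewrite avgZ avg_sum -!mulrA ler_wpM2l ?(ltW z0) //.
rewrite [_ - _]addrC expRD mulNr -!mulrA ler_wpM2l ?expR_ge0 //.
apply: (@le_trans _ _ (\sum_(i < n.+1 | J i) expR K * (n.+1%:R * i.+1%:R^-1))).
  apply: ler_sum => i Ji; have i_n : (i <= n)%N by rewrite -ltnS.
  rewrite (avg_expindeg _ i_n).
  have -> : z - 1 = 1 + eta by rewrite /z; ring.
  apply: (le_trans (prod_tilt_le eta1 i_n)).
  by rewrite mulrC ler_wpM2r ?divr_ge0 ?ler0n // ler_expR hK.
rewrite -!mulr_sumr ler_wpM2l ?expR_ge0 // ler_wpM2l ?ler0n //.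
apply: le_trans (sum_inv_le R n).
rewrite [leRHS](bigID (fun i : 'I_n.+1 => J i)) /= lerDl sumr_ge0 //.
Qed.

(** * Second moment: many vertices of large in-degree *)

Definition indeg_tail (R : realType) (n i D : nat) : R :=
  avg n (fun g => (D <= indeg g i)%N%:R).

Definition indeg_tail2 (R : realType) (n i j D E : nat) : R :=
  avg n (fun g => (D <= indeg g i)%N%:R * (E <= indeg g j)%N%:R).

Lemma indeg_tail_ge0 (R : realType) (n i D : nat) : 0 <= indeg_tail R n i D.
Proof. by apply: avg_ge0 => g; exact: ler0n. Qed.

Lemma indeg_tail0 (R : realType) (n i : nat) : indeg_tail R n i 0 = 1.
Proof. exact: avg_cst. Qed.

Lemma indeg_tail_new (R : realType) (n D : nat) : indeg_tail R n n D.+1 = 0.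
Proof.
rewrite -[RHS](avg_cst n 0); apply: eq_avg => g gn.
by rewrite (indeg_new_vertex gn).
Qed.

Lemma indeg_tailS (R : realType) (n i D : nat) : (i <= n)%N ->
  indeg_tail R n.+1 i D.+1 =
  indeg_tail R n i D.+1 + (indeg_tail R n i D - indeg_tail R n i D.+1) / n.+1%:R.
Proof.
move=> i_n; rewrite /indeg_tail (avg_indegS (fun a => (D < a)%N%:R) i_n).
by rewrite avgD avgZr avgB.
Qed.

Lemma indeg_tail2S (R : realType) (n i j D E : nat) : (i < j <= n)%N ->
  indeg_tail2 R n.+1 i j D.+1 E.+1 =
  indeg_tail2 R n i j D.+1 E.+1
  + (indeg_tail2 R n i j D E.+1 + indeg_tail2 R n i j D.+1 E
     - indeg_tail2 R n i j D.+1 E.+1 *+ 2)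
    / n.+1%:R.
Proof.
move=> ijn.
rewrite /indeg_tail2.
rewrite (avg_indeg2S (fun a => (D < a)%N%:R) (fun a => (E < a)%N%:R) ijn).
rewrite avgD avgZr mulr2n -!avgD -avgB; congr (_ + _ * _).
by apply: eq_avg => g _; rewrite !ltnS; ring.
Qed.

(** Negative correlation, by induction on n. The product of the two tails
    satisfies the recursion of the joint tail up to the additional term
    (a - a')(b - b')/(n + 1)^2 where both in-degrees increase; this term is
    nonnegative since tails decrease. *)
Lemma indeg_tail2_le (R : realType) (n i j D E : nat) : (i < j <= n)%N ->
  indeg_tail2 R n i j D E <= indeg_tail R n i D * indeg_tail R n j E.
Proof.
move=> /andP[ij]; elim: n D E => [|n IHn] D E; first by lia.
case: D => [|D].
  rewrite indeg_tail0 mul1r /indeg_tail2; under eq_avg do rewrite leq0n mul1r.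
  by [].
case: E => [|E].
  rewrite indeg_tail0 mulr1 /indeg_tail2; under eq_avg do rewrite leq0n mulr1.
  by [].
rewrite leq_eqVlt => /orP[/eqP ej|jn].
  rewrite ej indeg_tail_new mulr0 -[leRHS](avg_cst n.+1 0); apply: le_avg => g gn.
  by rewrite (indeg_new_vertex gn (leqnn _)) mulr0.
rewrite ltnS in jn; have i_n : (i <= n)%N by lia.
rewrite indeg_tail2S ?ij // (indeg_tailS _ _ i_n) (indeg_tailS _ _ jn).
have := IHn D E.+1 jn; have := IHn D.+1 E jn; have := IHn D.+1 E.+1 jn.
have tail_dec k F : indeg_tail R n k F.+1 <= indeg_tail R n k F.
  apply: le_avg => g _; rewrite ler_nat.
  by case: (F < indeg g k)%N / boolP => // /ltnW ->.
have := tail_dec i D; have := tail_dec j E.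
move: (indeg_tail R n i D) (indeg_tail R n j E).
move: (indeg_tail R n i D.+1) (indeg_tail R n j E.+1).
move: (indeg_tail2 R n i j D E.+1) (indeg_tail2 R n i j D.+1 E).
move: (indeg_tail2 R n i j D.+1 E.+1).
move=> r3 r1 r2 a' b' a b b'b a'a h3 h2 h1.
set x : R := n.+1%:R^-1.
have x0 : 0 <= x by rewrite invr_ge0 ler0n.
have x1 : 2 * x <= 1.
  rewrite /x ler_pdivrMr ?ltr0n // mul1r ler_nat; lia.
have -> : r3 + (r1 + r2 - r3 *+ 2) * x = (1 - 2 * x) * r3 + x * r1 + x * r2.
  by ring.
have -> : (a' + (a - a') * x) * (b' + (b - b') * x) =
  (1 - 2 * x) * (a' * b') + x * (a * b') + x * (a' * b)
  + x ^+ 2 * ((a - a') * (b - b')) by ring.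
have t : 0 <= x ^+ 2 * ((a - a') * (b - b')).
  by rewrite mulr_ge0 ?sqr_ge0 // mulr_ge0 // subr_ge0.
have u1 : x * r1 <= x * (a * b') by apply: ler_wpM2l.
have u2 : x * r2 <= x * (a' * b) by apply: ler_wpM2l.
have u3 : (1 - 2 * x) * r3 <= (1 - 2 * x) * (a' * b').
  by apply: ler_wpM2l => //; rewrite subr_ge0.
lra.
Qed.

Definition mean_num_indeg_ge (R : realType) (n D : nat) : R :=
  \sum_(i < n.+1) indeg_tail R n i D.

Definition num_indeg_ge (R : realType) (n D : nat) (g : digraph) : R :=
  \sum_(i < n.+1) (D <= indeg g i)%N%:R.

Lemma avg_num_indeg_ge (R : realType) (n D : nat) :
  avg n (num_indeg_ge R n D) = mean_num_indeg_ge R n D.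
Proof. exact: avg_sum. Qed.

Lemma indeg_tail2C (R : realType) (n i j D E : nat) :
  indeg_tail2 R n i j D E = indeg_tail2 R n j i E D.
Proof. by apply: eq_avg => g _; rewrite mulrC. Qed.

(** The diagonal terms contribute the mean, and negative correlation bounds the
    others by the square of the mean. *)
Lemma avg_num_indeg_ge_sqr (R : realType) (n D : nat) :
  avg n (fun g => num_indeg_ge R n D g ^+ 2)
  <= mean_num_indeg_ge R n D + mean_num_indeg_ge R n D ^+ 2.
Proof.
have -> : avg n (fun g => num_indeg_ge R n D g ^+ 2) =
    \sum_(i < n.+1) \sum_(j < n.+1) indeg_tail2 R n i j D D.
  under eq_bigr do rewrite -avg_sum.
  rewrite -avg_sum; apply: eq_avg => g _.
  rewrite expr2 /num_indeg_ge mulr_suml; apply: eq_bigr => i _.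
  by rewrite mulr_sumr.
rewrite expr2 /mean_num_indeg_ge mulr_suml -big_split /=; apply: ler_sum => i _.
rewrite mulr_sumr (bigD1 i) //= [in leRHS](bigD1 i) //=.
rewrite addrA lerD //.
  have -> : indeg_tail2 R n i i D D = indeg_tail R n i D.
    by apply: eq_avg => g _; case: (D <= _)%N; rewrite ?mulr1 ?mulr0.
  by rewrite lerDl mulr_ge0 // indeg_tail_ge0.
apply: ler_sum => j; rewrite -val_eqE /= neq_ltn => /orP[ji|ij].
  by rewrite indeg_tail2C mulrC indeg_tail2_le // ji -ltnS ltn_ord.
by rewrite indeg_tail2_le // ij -ltnS ltn_ord.
Qed.

(** Chebyshev's inequality, with the variance bounded by the mean. *)
Lemma avg_num_indeg_ge_eq0 (R : realType) (n D : nat) :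
  0 < mean_num_indeg_ge R n D ->
  avg n (fun g => (num_indeg_ge R n D g == 0)%:R) <= (mean_num_indeg_ge R n D)^-1.
Proof.
set a := mean_num_indeg_ge R n D => a0.
have -> : a^-1 = a^-2 * (a + a ^+ 2 - 2 * a * a + a ^+ 2).
  by field; rewrite gt_eqF.
have le2 : avg n (fun g => (num_indeg_ge R n D g - a) ^+ 2)
    <= a + a ^+ 2 - 2 * a * a + a ^+ 2.
  have e g : (num_indeg_ge R n D g - a) ^+ 2
      = num_indeg_ge R n D g ^+ 2 + (- 2 * a) * num_indeg_ge R n D g + a ^+ 2.
    by ring.
  under eq_avg do rewrite e.
  rewrite !avgD avgZ avg_cst avg_num_indeg_ge -/a.
  by have := avg_num_indeg_ge_sqr R n D; rewrite -/a; lra.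
apply: le_trans (ler_wpM2l _ le2); last by rewrite invr_ge0 sqr_ge0.
rewrite -avgZ; apply: le_avg => g _.
have [->|_] := eqVneq (num_indeg_ge R n D g) 0.
  by rewrite sub0r sqrrN mulVf // sqrf_eq0 gt_eqF.
by rewrite mulr_ge0 ?invr_ge0 ?sqr_ge0.
Qed.

Lemma mean_num_indeg_geS (R : realType) (n D : nat) :
  mean_num_indeg_ge R n.+1 D.+1 =
  mean_num_indeg_ge R n D.+1
  + (mean_num_indeg_ge R n D - mean_num_indeg_ge R n D.+1) / n.+1%:R.
Proof.
rewrite {1}/mean_num_indeg_ge big_ord_recr /= indeg_tail_new addr0.
rewrite (eq_bigr (fun i : 'I_n.+1 => indeg_tail R n i D.+1
  + (indeg_tail R n i D - indeg_tail R n i D.+1) / n.+1%:R)) => [|i _]; last first.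
  by rewrite indeg_tailS // -ltnS.
by rewrite big_split /= -mulr_suml sumrB.
Qed.

(** This is P(S_n < D) for S_n a sum of independent Bernoulli (2/(k + 1)),
    1 <= k <= n: doubling with each unit of in-degree is the change of measure
    at z = 2. The recursion of [tilted_cdfS] is the conditioning of S_(n+1) on
    its last summand. *)
Definition tilted_cdf (R : realType) (n D : nat) : R :=
  1 - 2 ^+ D * mean_num_indeg_ge R n D / n.+1%:R.

Lemma tilted_cdfS (R : realType) (n D : nat) :
  tilted_cdf R n.+1 D.+1 =
  (n%:R * tilted_cdf R n D.+1 + 2 * tilted_cdf R n D) / n.+2%:R.
Proof.
rewrite /tilted_cdf mean_num_indeg_geS exprS.
rewrite -[n.+2%:R]natr1 -[n.+1%:R]natr1.
have := ler0n R n => n0.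
field; by apply/andP; split; apply/eqP; lra.
Qed.

(** Chernoff's bound with base 3/4: E (3/4)^(S_n) is the product on the right,
    of order n^(-1/2). The base only has to satisfy (4/3)^2 < 2, so that the
    bound is small whenever 2^D is small compared to n. *)
Lemma tilted_cdf_le (R : realType) (n D : nat) :
  tilted_cdf R n D <= (4 / 3) ^+ D * \prod_(k < n) (1 - 1 / 2 / k.+2%:R).
Proof.
elim: n D => [|n IHn] [|D].
- rewrite /tilted_cdf /mean_num_indeg_ge big_ord1 indeg_tail0 big_ord0; lra.
- by rewrite /tilted_cdf /mean_num_indeg_ge big_ord1 indeg_tail_new big_ord0
    mulr0 mul0r subr0 mulr1 exprn_ege1 //; lra.
- have -> : tilted_cdf R n.+1 0 = 0.
    rewrite /tilted_cdf /mean_num_indeg_ge (eq_bigr (fun=> 1)) => [|i _];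
      last exact: indeg_tail0.
    by rewrite sumr_const card_ord expr0 mul1r divff ?subrr// pnatr_eq0.
  rewrite expr0 mul1r prodr_ge0 // => k _.
  rewrite subr_ge0 ler_pdivrMr ?ltr0n // mul1r.
  have : (1 : R) <= k.+2%:R by rewrite ler1n.
  lra.
rewrite tilted_cdfS big_ord_recr /=.
have n0 := ler0n R n.
apply: (@le_trans _ _
  ((n%:R * ((4 / 3) ^+ D.+1 * \prod_(k < n) (1 - 1 / 2 / k.+2%:R))
  + 2 * ((4 / 3) ^+ D * \prod_(k < n) (1 - 1 / 2 / k.+2%:R))) / n.+2%:R)).
  by rewrite ler_wpM2r ?invr_ge0 ?ler0n // lerD // ler_wpM2l // IHn.
rewrite le_eqVlt; apply/orP; left; apply/eqP.
rewrite exprS -[n.+2%:R]natr1 -[n.+1%:R]natr1.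
by field; apply/eqP; lra.
Qed.

Lemma sqr_prod_half_le (R : realType) (n : nat) :
  (\prod_(k < n) (1 - 1 / 2 / k.+2%:R)) ^+ 2 <= 2 / n.+2%:R :> R.
Proof.
elim: n => [|n IHn]; first by rewrite big_ord0; lra.
rewrite big_ord_recr /= exprMn.
apply: le_trans (ler_wpM2r (sqr_ge0 _) IHn) _.
have n0 := ler0n R n.
rewrite -[n.+3%:R]natr1 -[n.+2%:R]natr1 -[n.+1%:R]natr1.
move: (n%:R) n0 => x x0.
rewrite -subr_ge0.
have -> : 2 / (x + 1 + 1 + 1) - 2 / (x + 1 + 1) * (1 - 1 / 2 / (x + 1 + 1)) ^+ 2
  = 2 * (3 / 4 * x + 5 / 4) / ((x + 1 + 1) ^+ 3 * (x + 1 + 1 + 1)) by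
  field; apply/andP; split; apply/eqP; lra.
by rewrite divr_ge0 // ?mulr_ge0 ?exprn_ge0 //; lra.
Qed.

(** Squaring the Chernoff bound gives at most (16/9)^D 2/(n + 2), and
    (16/9)^D <= 2^D <= (n + 2)/8. *)
Lemma mean_num_indeg_ge_lb (R : realType) (n D : nat) : (8 * 2 ^ D <= n.+2)%N ->
  n.+1%:R / 2 ^+ D.+1 <= mean_num_indeg_ge R n D.
Proof.
move=> hD.
set p : R := \prod_(k < n) (1 - 1 / 2 / k.+2%:R).
have d2 : (4 / 3) ^+ D * p <= 1 / 2.
  apply: (@le_trans _ _ `|(4 / 3) ^+ D * p|); first exact: ler_norm.
  rewrite -[leRHS]ger0_norm; last lra.
  rewrite -ler_sqr ?nnegrE // !real_normK ?num_real // exprMn -exprM mulnC exprM.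
  apply: (@le_trans _ _ (2 ^+ D * (2 / n.+2%:R))).
    apply: ler_pM; rewrite ?sqr_ge0 ?exprn_ge0 ?sqr_prod_half_le //.
    by apply: lerXn2r; rewrite ?nnegrE; lra.
  rewrite mulrA ler_pdivrMr ?ltr0n //.
  have : (8 * 2 ^ D)%N%:R <= n.+2%:R :> R by rewrite ler_nat.
  rewrite natrM natrX; lra.
have := le_trans (tilted_cdf_le R n D) d2; rewrite /tilted_cdf.
set q := _ / n.+1%:R => hq.
have hq2 : 1 / 2 <= q by lra.
have e : mean_num_indeg_ge R n D = q * n.+1%:R / 2 ^+ D.
  by rewrite /q; field; rewrite expf_neq0 //= ?pnatr_eq0 //=.
rewrite e exprS invfM mulrA ler_wpM2r ?invr_ge0 ?exprn_ge0 //.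
by rewrite mulrC ler_wpM2r ?ler0n //; lra.
Qed.

Lemma avg_num_indeg_ge_eq0_le (R : realType) (n D : nat) :
  (8 * 2 ^ D <= n.+2)%N ->
  avg n (fun g => (num_indeg_ge R n D g == 0)%:R) <= 2 ^+ D.+1 / n.+1%:R :> R.
Proof.
move=> /(mean_num_indeg_ge_lb R) h.
have p : 0 < n.+1%:R / 2 ^+ D.+1 :> R by rewrite divr_gt0 ?ltr0n ?exprn_gt0.
have a0 := lt_le_trans p h.
apply: le_trans (avg_num_indeg_ge_eq0 a0) _.
by rewrite -[leRHS]invrK invf_div lef_pV2.
Qed.

(** * From probabilities to averages *)

Lemma prob_tree_le d (T : measurableType d) (R : realType)
    (P : probability T R) (G : nat -> T -> digraph) (n : nat) (g : digraph) :
  uniform_random_tree P G -> g \in recursive_trees n ->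
  (P [set w | G n w = g] <= (n`!%:R^-1)%:E)%E.
Proof.
move=> hG; elim: n g => [|n IHn] g.
  move=> _; rewrite invr1 probability_le1 //.
  exact: attachment_tree_measurable hG _ _.
move=> /mem_recursive_treesS[h [j [hn jn ->]]].
have -> : [set w | G n.+1 w = rcons h (n.+1, j)]
    = [set w | G n w = h /\ G n.+1 w = rcons h (n.+1, j)].
  apply/seteqP; split => w /= => [e|[]//]; split=> //.
  have [k _] := attachment_tree_grow hG n w; rewrite e.
  by move=> /rcons_inj[].
rewrite (attachment_tree_step hG) // sumr_const card_ord.
rewrite mul1r factS natrM invfM mulrC EFinM; apply: lee_pmul => //.
exact: IHn.
Qed.

Lemma tree_mem_recursive_trees d (T : measurableType d) (R : realType)
    (P : probability T R) (G : nat -> T -> digraph) (n : nat) (w : T) :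
  uniform_random_tree P G -> G n w \in recursive_trees n.
Proof.
move=> hG; elim: n => [|n IHn]; first by rewrite (attachment_tree_init hG) inE.
have [j jn ->] := attachment_tree_grow hG n w.
by apply/allpairsP; exists (G n w, j); rewrite mem_iota /= add0n ltnS.
Qed.

(** The tree takes its values in a finite list, so the event is a finite union
    of atoms, each of probability at most 1/n!. *)
Lemma prob_le_avg d (T : measurableType d) (R : realType)
    (P : probability T R) (G : nat -> T -> digraph) (n : nat) (B : pred digraph) :
  uniform_random_tree P G ->
  (P [set w | B (G n w)] <= (avg n (fun g => (B g)%:R))%:E)%E.
Proof.
move=> hG.
have mG g : measurable [set w | G n w = g] := attachment_tree_measurable hG n g.
have -> : [set w | B (G n w)] =
    \big[setU/set0]_(g <- recursive_trees n | B g) [set w | G n w = g].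
  rewrite -bigcup_seq_cond; apply/seteqP; split => w /=.
    by move=> Bw; exists (G n w) => //=; rewrite (tree_mem_recursive_trees _ _ hG).
  by case=> g /= /andP[_ Bg] ->.
rewrite /avg mulr_sumr.
have : {subset recursive_trees n <= recursive_trees n} by [].
elim: {1 3 4}(recursive_trees n) => [|g s IHs] sub.
  by rewrite !big_nil measure0.
rewrite !big_cons.
have {}IHs := IHs (fun h hs => sub h (mem_behead (hs : h \in behead (g :: s)))).
case: ifP => Bg; last by rewrite mulr0 add0r.
rewrite mulr1 EFinD; apply: le_trans (measureU2 _ _ _) _ => //.
  exact: bigsetU_measurable.
by rewrite leeD // (prob_tree_le hG) // sub ?mem_head.
Qed.

(** * Events of vanishing average *)

Lemma cvg_expR_ln (R : realType) (C gamma : R) : 0 < gamma ->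
  C * expR (- (gamma * ln n%:R)) @[n --> \oo] --> (0 : R).
Proof.
move=> g0; rewrite -[X in _ --> X](mulr0 C); apply: cvgMr.
apply: (@cvg_comp _ _ _ (fun n : nat => gamma * ln n%:R) (fun x => expR (- x)));
  last exact: cvgr_expR.
apply/cvgryPge => A; have := nbhs_infty_ger (expR (A / gamma)).
apply: filterS => n hn; rewrite mulrC -ler_pdivrMr //.
rewrite -ler_expR lnK // posrE; exact: lt_le_trans (expR_gt0 _) hn.
Qed.

Definition vanishing (R : realType) (B : nat -> pred digraph) :=
  avg n (fun g => (B n g)%:R) @[n --> \oo] --> (0 : R).

Lemma vanishing_squeeze (R : realType) (B : nat -> pred digraph) (u : nat -> R) :
  u n @[n --> \oo] --> (0 : R) ->
  (\forall n \near \oo, avg n (fun g => (B n g)%:R) <= u n) ->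
  vanishing R B.
Proof.
move=> u0 hu; apply: (@squeeze_cvgr _ _ _ _ (cst 0) u) => //; last exact: cvg_cst.
apply: filterS hu => n ->; rewrite andbT.
by apply: avg_ge0 => g; exact: ler0n.
Qed.

Lemma vanishing_exp (R : realType) (B : nat -> pred digraph) (C gamma : R) :
  0 < gamma ->
  (\forall n \near \oo,
     avg n (fun g => (B n g)%:R) <= C * expR (- (gamma * ln n%:R))) ->
  vanishing R B.
Proof. by move=> g0; apply: vanishing_squeeze; exact: cvg_expR_ln. Qed.

Lemma vanishingU (R : realType) (B1 B2 B : nat -> pred digraph) :
  vanishing R B1 -> vanishing R B2 ->
  (\forall n \near \oo, forall g, g \in recursive_trees n ->
     B n g -> B1 n g || B2 n g) ->
  vanishing R B.
Proof.
move=> v1 v2 h; have v := cvgD v1 v2; rewrite addr0 in v.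
apply: (vanishing_squeeze (u := fun n => avg n (fun g => (B1 n g)%:R)
  + avg n (fun g => (B2 n g)%:R)));
  first exact: v.
apply: filterS h => n h.
rewrite -[leRHS]avgD; apply: le_avg => g gn; rewrite -natrD ler_nat.
by have := h g gn; case: (B n g) => // /(_ isT); case: (B1 n g); case: (B2 n g).
Qed.

Lemma vanishing_cvg d (T : measurableType d) (R : realType)
    (P : probability T R) (G : nat -> T -> digraph) (B : nat -> pred digraph) :
  uniform_random_tree P G -> vanishing R B ->
  P [set w | B n (G n w)] @[n --> \oo] --> 0%E.
Proof.
move=> hG v.
apply: (@squeeze_cvge _ _ _ _ (cst 0%E) _
  (fun n => (avg n (fun g => (B n g)%:R))%:E)); last first.
- by apply: cvg_EFin => //; apply: nearW.
- exact: cvg_cst.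
by apply: nearW => n; rewrite measure_ge0 /=; exact: prob_le_avg hG.
Qed.

(** * The maximal degree and its index *)

Lemma degree_le_max (n : nat) (g : digraph) (i : nat) : (i <= n)%N ->
  (degree g i <= max_degree n g)%N.
Proof.
rewrite -ltnS => i_n.
exact: (leq_bigmax (F := fun i : 'I_n.+1 => degree g i) (Ordinal i_n)).
Qed.

Lemma ex_max_degree (n : nat) (g : digraph) :
  exists i : 'I_n.+1, max_degree n g = degree g i.
Proof.
have [|i _ e] := @eq_bigmax_cond 'I_n.+1 predT (fun i => degree g i).
  by rewrite card_ord.
by exists i.
Qed.

Lemma oldest_max_indexP (n : nat) (g : digraph) :
  (oldest_max_index n g <= n)%N /\
  degree g (oldest_max_index n g) = max_degree n g.
Proof.
set a := fun i => all (fun j => (degree g j <= degree g i)%N) (iota 0 n.+1).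
have ha : has a (iota 0 n.+1).
  have [i e] := ex_max_degree n g; apply/hasP; exists (val i).
    by rewrite mem_iota /= add0n.
  by apply/allP => j; rewrite mem_iota /= add0n ltnS -e; exact: degree_le_max.
have I_n : (oldest_max_index n g < n.+1)%N.
  by have := ha; rewrite has_find size_iota.
split; first by [].
have := nth_find 0%N ha; rewrite -/(oldest_max_index n g) nth_iota // add0n.
move=> /allP h; apply/eqP; rewrite eqn_leq degree_le_max //=.
have [i ->] := ex_max_degree n g.
by apply: h; rewrite mem_iota /= add0n.
Qed.

(** This makes the exponent 1 - 1/(2 ln 2) positive. The bound used is
    ln 2 = ln 4 - ln 2 >= 1/3 + 1/4. *)
Lemma ln2_gt (R : realType) : 1 / 2 < ln (2 : R).
Proof.
have h2 := @inv_le_lnB R 2 isT; have h3 := @inv_le_lnB R 3 isT.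
have e : ln (4 : R) = 2 * ln 2.
  have -> : (4 : R) = 2 ^+ 2 by ring.
  by rewrite lnXn // mulr_natl.
rewrite e in h3.
move: h2 h3; move: (ln (3 : R)) (ln (2 : R)) => a b; lra.
Qed.

Lemma ln2_le1 (R : realType) : ln (2 : R) <= 1.
Proof. by have := lnB_le_inv R 0; rewrite ln1 subr0 invr1. Qed.

(** A second-order lower bound for ln at 2: the derivative 1/2 there is what
    produces the exponent 1 - 1/(2 ln 2). *)
Lemma ln_near2_ge (R : realType) (eta : R) : `|eta| <= 1 / 4 ->
  ln 2 + eta / 2 - eta ^+ 2 / 2 <= ln (2 + eta).
Proof.
rewrite ler_norml => /andP[h1 h2]; set t := eta / 2.
have t1 : 0 < 1 + t by rewrite /t; lra.
have -> : 2 + eta = 2 * (1 + t) by rewrite /t; field.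
rewrite lnM ?posrE // -addrA lerD2l.
have u1 : t / (1 + t) < 1 by rewrite ltr_pdivrMr // mul1r; lra.
have := @le_ln1Dx R (- (t / (1 + t))); rewrite ltrN2 => /(_ u1).
have -> : 1 - t / (1 + t) = (1 + t)^-1 by field; rewrite gt_eqF.
rewrite lnV ?posrE // lerN2; apply: le_trans.
rewrite ler_pdivlMr //.
have -> : eta ^+ 2 / 2 = 2 * t ^+ 2 by rewrite /t; field.
rewrite -/t -subr_ge0.
have -> : t - (t - 2 * t ^+ 2) * (1 + t) = t ^+ 2 * (1 + 2 * t) by ring.
by rewrite mulr_ge0 ?sqr_ge0 // /t; lra.
Qed.

(** Take D just above (1/ln 2 - delta) ln n. Then 2^D is at most
    2 n^(1 - delta ln 2), so the expected number of vertices of in-degree at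
    least D tends to infinity. *)
Lemma vanishing_small_max (R : realType) (delta : R) :
  0 < delta -> delta <= (ln 2)^-1 ->
  vanishing R (fun n g =>
    (max_degree n g)%:R < ((ln 2)^-1 - delta) * ln n%:R).
Proof.
move=> d0 dc; have l2 := ln2_gt R; have l20 : 0 < ln (2 : R) by lra.
have g0 : 0 < delta * ln 2 by rewrite mulr_gt0.
apply: (@vanishing_exp _ _ 4 _ g0).
have := cvg_expR_ln 16 g0 => /cvgr_lt /(_ 1 ltr01) hev.
near=> n.
have n1 : (1 <= n)%N by near: n; exact: nbhs_infty_ge.
have nR : (0 : R) < n%:R by rewrite ltr0n.
have hn : 16 * expR (- (delta * ln 2 * ln n%:R)) < 1 :> R by near: n.
set L := ln n%:R in hn *.
have L0 : 0 <= L by rewrite ln_ge0 // ler1n.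
set y := ((ln 2)^-1 - delta) * L.
have y0 : 0 <= y by rewrite mulr_ge0 // subr_ge0.
pose k := Num.truncn y.
have k2 : (2 : R) ^+ k <= n%:R * expR (- (delta * ln 2 * L)).
  have -> : (2 : R) ^+ k = expR (k%:R * ln 2) by rewrite expRM_natl lnK // posrE.
  have -> : n%:R = expR L by rewrite /L lnK.
  rewrite -expRD ler_expR.
  have -> : L - delta * ln 2 * L = y * ln 2 by rewrite /y; field; rewrite gt_eqF.
  by rewrite ler_wpM2r ?(ltW l20) // truncn_le.
have hD : (8 * 2 ^ k.+1 <= n.+2)%N.
  rewrite -(ler_nat R) natrM natrX exprS.
  have : 16 * (2 : R) ^+ k <= n%:R.
    apply: (@le_trans _ _ (16 * (n%:R * expR (- (delta * ln 2 * L))))).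
      by rewrite ler_wpM2l.
    by rewrite mulrCA -[leRHS]mulr1 ler_wpM2l // ltW.
  move=> h; apply: (@le_trans _ _ n%:R); last by rewrite ler_nat -addn2 leq_addr.
  by apply: le_trans h; rewrite mulrA -natrM.
apply: (@le_trans _ _ (avg n (fun g => (num_indeg_ge R n k.+1 g == 0)%:R))).
  apply: le_avg => g gn; rewrite ler_nat.
  case: ltP => //= hlt; rewrite lt0b psumr_eq0 //.
  apply/allP => i _ /=; rewrite pnatr_eq0 eqb0 -ltnNge ltnS.
  have /andP[di _] := degree_bounds i gn.
  have i_n : (i <= n)%N by rewrite -ltnS ltn_ord.
  rewrite leqNgt; apply/negP => hk; suff : y < (max_degree n g)%:R.
    by rewrite ltNge (ltW hlt).
  apply: lt_le_trans (truncnS_gt y) _; rewrite ler_nat.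
  exact: leq_trans hk (leq_trans di (degree_le_max g i_n)).
apply: (le_trans (avg_num_indeg_ge_eq0_le R hD)).
rewrite !exprS ler_pdivrMr ?ltr0n //.
have -> : 4 * expR (- (delta * ln 2 * L)) * n.+1%:R
  = 2 * (2 * (n.+1%:R * expR (- (delta * ln 2 * L)))) by ring.
rewrite !ler_wpM2l //; apply: (le_trans k2).
by rewrite ler_wpM2r ?expR_ge0 // ler_nat.
Unshelve. all: by end_near.
Qed.

Lemma lnS_le (R : realType) (n : nat) : (0 < n)%N -> ln n.+1%:R <= ln (n%:R : R) + 1.
Proof.
case: n => // n _; have := lnB_le_inv R n.
have : (n.+1%:R^-1 : R) <= 1 by rewrite invf_le1 ?ltr0n // ler1n.
by move: (n.+1%:R^-1 : R) (ln (n.+2%:R : R)) (ln (n.+1%:R : R)) => a b c; lra.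
Qed.

(** The asymptotic form of [avg_exists_degree_le]: its polynomial factor
    n (1 + ln n) is absorbed by ln n in the exponent and by half of gamma. The
    constant 6 comes from 2 + eta <= 3 and n + 1 <= 2 n. *)
Lemma vanishing_exists_degree (R : realType) (eta gamma : R) (K y : nat -> R)
    (J : nat -> pred nat) :
  -1 <= eta <= 1 -> 0 < gamma ->
  (forall n i, (2 <= n)%N -> (i <= n)%N -> J n i ->
     eta * harmonic_gap R i n <= K n) ->
  (forall n, (2 <= n)%N ->
     K n - y n * ln (2 + eta) + ln n%:R <= - (gamma * ln n%:R) + 2) ->
  vanishing R (fun n g =>
    [exists i : 'I_n.+1, J n i && (y n <= (degree g i)%:R)]).
Proof.
move=> /andP[eta1 eta2] g0 hK hy.
have g20 : 0 < gamma / 2 by rewrite divr_gt0.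
apply: (@vanishing_exp _ _ (6 * expR 2 * (2 / gamma + 2)) _ g20).
near=> n.
have n2 : (2 <= n)%N by near: n; exact: nbhs_infty_ge.
have nR : (0 : R) < n%:R by rewrite ltr0n; lia.
apply: (le_trans (avg_exists_degree_le (y n) eta1 (hK n ^~ n2))).
have lS := lnS_le R (ltnW n2).
have hn := hy n n2.
have nL : n%:R = expR (ln (n%:R : R)) by rewrite lnK.
have L0 : 0 <= ln (n%:R : R) by rewrite ln_ge0 // ler1n ltnW.
have nS : n.+1%:R <= 2 * expR (ln n%:R) :> R.
  by rewrite -nL -natrM ler_nat mul2n -addnn -addn1 leq_add2l ltnW.
have L10 : 0 <= 1 + ln (n.+1%:R : R) by rewrite addr_ge0 // ln_ge0 // ler1n.
move: lS hn L0 nS L10.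
move: (ln (n%:R : R)) (ln (n.+1%:R : R)) => L L1 lS hn L0 nS L10.
(* E is a square root of the available decay n^gamma: one factor E absorbs
   1 + ln (n + 1), the other remains in the final bound. *)
set E := expR (gamma / 2 * L).
have E1 : 1 + gamma / 2 * L <= E by exact: expR_ge1Dx.
have gL : 0 <= gamma / 2 * L by rewrite mulr_ge0 // ltW.
have hL : 1 + L1 <= (2 / gamma + 2) * E.
  have e1 : (2 / gamma) * (gamma / 2 * L) = L by field; rewrite gt_eqF.
  have : 2 / gamma * (gamma / 2 * L) <= 2 / gamma * E.
    by rewrite ler_wpM2l ?divr_ge0 ?(ltW g0) //; lra.
  by rewrite e1 mulrDl; lra.
have hexp :
    expR (K n - y n * ln (2 + eta)) <= expR 2 * expR (- L) * (E^-1 * E^-1).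
  by rewrite -expRN -!expRD ler_expR; lra.
apply: (@le_trans _ _ (3 * (expR 2 * expR (- L) * (E^-1 * E^-1))
   * (2 * expR L * ((2 / gamma + 2) * E)))).
  apply: ler_pM.
  - by rewrite mulr_ge0 ?expR_ge0 //; lra.
  - by rewrite mulr_ge0 ?ler0n.
  - by apply: ler_pM; rewrite ?expR_ge0 //; lra.
  - by apply: ler_pM; rewrite ?ler0n.
rewrite expRN [expR (- (_ * _))]expRN -/E.
rewrite le_eqVlt; apply/orP; left; apply/eqP; field.
by rewrite !expR_eq0 /= gt_eqF.
Unshelve. all: by end_near.
Qed.

Lemma vanishing_large_max (R : realType) (eps : R) : 0 < eps ->
  vanishing R (fun n g =>
    ((ln 2)^-1 + eps) * ln n%:R <= (max_degree n g)%:R).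
Proof.
move=> e0; have l2 := ln2_gt R; have l20 : 0 < ln (2 : R) by lra.
have v : vanishing R (fun n g => [exists i : 'I_n.+1,
    predT (val i) && (((ln 2)^-1 + eps) * ln n%:R <= (degree g i)%:R)]).
  apply: (@vanishing_exists_degree R 0 (eps * ln 2) (fun=> 0)
    (fun n => ((ln 2)^-1 + eps) * ln n%:R) (fun=> predT)).
  - by lra.
  - by rewrite mulr_gt0.
  - by move=> n i _ _ _; rewrite mul0r.
  move=> n _; rewrite addr0.
  have -> : 0 - ((ln 2)^-1 + eps) * ln n%:R * ln 2 + ln n%:R
    = - (eps * ln 2 * ln n%:R) by field; rewrite gt_eqF.
  by rewrite lerDl.
apply: (vanishingU v v); apply: nearW => n g _ h; rewrite orbb.
by have [i e] := ex_max_degree n g; apply/existsP; exists i; rewrite -e.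
Qed.

(** Put c = 1/ln 2. The hypothesis on J says that its indices lie beyond
    n^(1 - c/2) by a factor n^eps, above for eta > 0 and below for eta < 0. With
    delta = eps^2/32 for the loss in the degree, the first-order terms in eta
    cancel and the exponent of n is at most
    - eps^2/4 + eta^2 + 2 delta = - eps^2/8. *)
Lemma vanishing_far_index (R : realType) (eps eta : R) (J : nat -> pred nat) :
  0 < eps <= 1 -> `|eta| = eps / 4 ->
  (forall n i, (2 <= n)%N -> (i <= n)%N -> J n i ->
     eta * harmonic_gap R i n
     <= (eta * ((ln 2)^-1 / 2) - eps ^+ 2 / 4) * ln n%:R + 2) ->
  vanishing R (fun n g => [exists i : 'I_n.+1, J n i &&
    (((ln 2)^-1 - eps ^+ 2 / 32) * ln n%:R <= (degree g i)%:R)]).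
Proof.
move=> /andP[e0 e1] eeta hJ.
have l2 := ln2_gt R; have l21 := ln2_le1 R; have l20 : 0 < ln (2 : R) by lra.
have eta4 : `|eta| <= 1 / 4 by lra.
have eta2 : eta ^+ 2 = eps ^+ 2 / 16.
  by rewrite -real_normK ?num_real // eeta; field.
have /andP[etal etau] : - (1 / 4) <= eta <= 1 / 4 by rewrite -ler_norml.
have c1 : 1 <= (ln 2)^-1 :> R by rewrite invf_ge1.
have c2 : (ln 2)^-1 <= 2 :> R by rewrite invf_ple ?posrE //; lra.
have ee : 0 < eps ^+ 2 by rewrite exprn_gt0.
have ee1 : eps ^+ 2 <= 1 by rewrite expr_le1 // ltW.
have hln := ln_near2_ge eta4; rewrite eta2 in hln.
apply: (@vanishing_exists_degree R eta (eps ^+ 2 / 8)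
  (fun n => (eta * ((ln 2)^-1 / 2) - eps ^+ 2 / 4) * ln n%:R + 2)
  (fun n => ((ln 2)^-1 - eps ^+ 2 / 32) * ln n%:R) J).
- by lra.
- by rewrite divr_gt0.
- by move=> n i n2 i_n /(hJ n i n2 i_n).
move=> n n2; have L0 : 0 <= ln (n%:R : R) by rewrite ln_ge0 // ler1n ltnW.
have cl : (ln 2)^-1 * ln 2 = 1 :> R by rewrite mulVf // gt_eqF.
move: hln c1 c2 cl L0 ee ee1.
move: (ln (n%:R : R)) (ln (2 + eta)) ((ln 2)^-1) (eps ^+ 2).
move=> L l c q hln c1 c2 cl L0 q0 q1.
have m : (c - q / 32) * (ln 2 + eta / 2 - q / 16 / 2) <= (c - q / 32) * l.
  by rewrite ler_wpM2l //; lra.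
have cq : c * q <= 2 * q by rewrite ler_wpM2r // ltW.
have dq : q * (ln 2 + eta / 2 - q / 16 / 2) <= q * 2.
  by rewrite ler_wpM2l ?(ltW q0) //; lra.
have co : eta * (c / 2) - q / 4 + 1 - (c - q / 32) * l <= - (q / 8).
  have ex : (c - q / 32) * (ln 2 + eta / 2 - q / 16 / 2)
    = c * ln 2 + eta * (c / 2) - c * q / 32
      - (q * (ln 2 + eta / 2 - q / 16 / 2)) / 32 by field.
  rewrite ex cl in m; lra.
have := ler_wpM2r L0 co; lra.
Qed.

(** A vertex of maximal degree has degree at least (1/ln 2 - d) ln n, which
    indices on either side are unlikely to reach. Here ln 0 = 0 puts the root
    among the small indices, since eps <= 1 - 1/(2 ln 2). *)
Lemma vanishing_far_max_index (R : realType) (eps : R) :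
  0 < eps -> eps <= 1 - (ln 2)^-1 / 2 ->
  vanishing R (fun n g =>
    let l := ln ((oldest_max_index n g)%:R : R) in
    (l <= (1 - (ln 2)^-1 / 2 - eps) * ln n%:R)
    || ((1 - (ln 2)^-1 / 2 + eps) * ln n%:R <= l)).
Proof.
move=> e0 ex; have l2 := ln2_gt R; have l20 : 0 < ln (2 : R) by lra.
have c0 : 0 < (ln 2)^-1 :> R by rewrite invr_gt0.
have c1 : 1 <= (ln 2)^-1 :> R by rewrite invf_ge1 // ln2_le1.
move: (ex); set c : R := (ln 2)^-1 in c0 c1 *; move=> ex'.
have e1 : 0 < eps <= 1 by lra.
pose d := eps ^+ 2 / 32.
have ee : 0 < eps ^+ 2 by rewrite exprn_gt0.
have ee1 : eps ^+ 2 <= 1 by rewrite expr_le1 //; lra.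
have vs : vanishing R (fun n g => (max_degree n g)%:R < (c - d) * ln n%:R).
  by apply: vanishing_small_max; rewrite -?/c /d; lra.
have k1 n i : (2 <= n)%N -> (i <= n)%N ->
    (1 - c / 2 + eps) * ln n%:R <= ln (i%:R : R) ->
    eps / 4 * harmonic_gap R i n
      <= (eps / 4 * (c / 2) - eps ^+ 2 / 4) * ln n%:R + 2.
  move=> n2 i_n hi.
  have n1 := ltnW n2.
  have Lp : 0 < ln (n%:R : R) by rewrite ln_gt0 // ltr1n.
  have i0 : (0 < i)%N.
    rewrite lt0n; apply/eqP => i0; move: hi; rewrite i0 (ln0 (lexx 0)).
    by rewrite leNgt mulr_gt0 //; lra.
  have hs := harmonic_gap_le R i_n; have hL := lnS_le R n1.
  have hS : ln (i%:R : R) <= ln (i.+1%:R : R).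
    by rewrite ler_ln ?posrE ?ltr0n // ler_nat.
  have h : harmonic_gap R i n <= (c / 2 - eps) * ln n%:R + 1.
    move: hs hL hS hi.
    move: (ln (i%:R : R)) (ln (i.+1%:R : R)) (ln (n%:R : R)).
    move: (ln (n.+1%:R : R)) (harmonic_gap R i n).
    by move=> a1 a2 a3 a4 a5; lra.
  have e4 : 0 <= eps / 4 by lra.
  have := ler_wpM2l e4 h.
  by move: (ln (n%:R : R)) (harmonic_gap R i n) => a b; rewrite -/c; nra.
have k2 n i : (2 <= n)%N -> (i <= n)%N ->
    ln (i%:R : R) <= (1 - c / 2 - eps) * ln n%:R ->
    - (eps / 4) * harmonic_gap R i n
      <= (- (eps / 4) * (c / 2) - eps ^+ 2 / 4) * ln n%:R + 2.
  move=> n2 i_n hi.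
  have Lp : 0 < ln (n%:R : R) by rewrite ln_gt0 // ltr1n.
  have hs := harmonic_gap_ge R i_n.
  have hn : ln (n%:R : R) <= ln (n.+2%:R : R).
    by rewrite ler_ln ?posrE ?ltr0n ?(ltnW n2) // ler_nat -addn2 leq_addr.
  have hS : ln (i.+2%:R : R) <= (1 - c / 2 - eps) * ln n%:R + 2.
    case: i hi {i_n hs} => [_|i hi].
      have : 0 <= (1 - c / 2 - eps) * ln (n%:R : R).
        by rewrite mulr_ge0 ?(ltW Lp) //; lra.
      have := ln2_le1 R; lra.
    have := @lnS_le R i.+1 isT; have := @lnS_le R i.+2 isT; move: hi.
    by move: (ln (i.+1%:R : R)) (ln (i.+2%:R : R)) (ln (i.+3%:R : R)) => a1 a2 a3; lra.
  have h : (c / 2 + eps) * ln n%:R - 2 <= harmonic_gap R i n.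
    move: hs hn hS.
    move: (ln (i.+2%:R : R)) (ln (n%:R : R)) (ln (n.+2%:R : R)).
    move: (harmonic_gap R i n).
    by move=> a1 a2 a3 a4; lra.
  have e4 : 0 <= eps / 4 by lra.
  have := ler_wpM2l e4 h.
  by move: (ln (n%:R : R)) (harmonic_gap R i n) => a b; rewrite -/c; nra.
have a1 : `|eps / 4| = eps / 4 by rewrite ger0_norm //; lra.
have a2 : `|- (eps / 4)| = eps / 4 by rewrite normrN.
have v1 := vanishing_far_index e1 a1 k1.
have v2 := vanishing_far_index e1 a2 k2.
pose far n g := [exists i : 'I_n.+1,
  ((ln (i%:R : R) <= (1 - c / 2 - eps) * ln n%:R)
   || ((1 - c / 2 + eps) * ln n%:R <= ln (i%:R : R)))
  && ((c - d) * ln n%:R <= (degree g i)%:R)].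
have vfar : vanishing R far.
  apply: (vanishingU v1 v2); apply: nearW => n g _ /existsP[i].
  by rewrite andb_orl => /orP[hi|hi]; apply/orP; [right|left];
    apply/existsP; exists i.
apply: (vanishingU vs vfar); apply: nearW => n g gn /=.
have [I_n dI] := oldest_max_indexP n g.
case: ltP => //= hmax hI; apply/existsP.
exists (Ordinal (I_n : (oldest_max_index n g < n.+1)%N)).
by rewrite /= hI dI.
Qed.

Theorem theorem4p14 (d : measure_display) (T : measurableType d) (R : realType)
    (P : probability T R) (G : nat -> T -> digraph)
    (hG : uniform_random_tree P G) :
  cvg_in_probability P
    (fun n w =>
       (lne ((oldest_max_index n (G n w))%:R)%:E / (ln (n%:R : R))%:E)%E)
    (1 - 1 / (2 * ln 2)) /\
  cvg_in_probability P
    (fun n w => ((max_degree n (G n w))%:R / ln n%:R)%:E)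
    (1 / ln 2).
Proof.
have l2 := ln2_gt R; have l20 : 0 < ln (2 : R) by lra.
have c0 : 0 < (ln 2)^-1 :> R by rewrite invr_gt0.
have c2 : (ln 2)^-1 < 2 :> R by rewrite invf_plt ?posrE //; lra.
split=> eps eps0.
  (* The minimum keeps 1 - 1/(2 ln 2) - e nonnegative, so that index 0, whose
     logarithm is -oo in the statement, is a small index. *)
  pose e := Num.min eps (1 - (ln 2)^-1 / 2).
  have e0 : 0 < e by rewrite lt_min eps0 /=; lra.
  have ec : e <= 1 - (ln 2)^-1 / 2 by rewrite ge_min lexx orbT.
  have ee : e <= eps by rewrite ge_min lexx.
  have xE : 1 - 1 / (2 * ln 2) = 1 - (ln 2)^-1 / 2 :> R by field; rewrite gt_eqF.
  rewrite xE.
  pose B n g := (eps%:E < `| lne ((oldest_max_index n g)%:R)%:E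
    / (ln (n%:R : R))%:E - (1 - (ln 2)^-1 / 2)%:E |)%E.
  apply: (vanishing_cvg (B := B) hG).
  have v := vanishing_far_max_index e0 ec.
  apply: (vanishingU v v); near=> n; move=> g _; rewrite orbb /B => {B}.
  have n2 : (2 <= n)%N by near: n; exact: nbhs_infty_ge.
  have Lp : 0 < ln (n%:R : R) by rewrite ln_gt0 // ltr1n.
  set I := oldest_max_index n g.
  have [->|I0] := posnP I.
    move=> _; apply/orP; left.
    by rewrite (ln0 (lexx 0)) mulr_ge0 ?(ltW Lp) //; lra.
  rewrite lne_EFin ?ltr0n // inver gt_eqF //= lte_fin.
  set l := ln I%:R; set L := ln n%:R in Lp *.
  rewrite lter_normr => /orP[h|h]; apply/orP; [right|left].
    rewrite -ler_pdivlMr //; lra.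
  rewrite -ler_pdivrMr //; lra.
pose e := Num.min eps (ln 2)^-1.
have e0 : 0 < e by rewrite lt_min eps0 /=.
have ec : e <= (ln 2)^-1 by rewrite ge_min lexx orbT.
have ee : e <= eps by rewrite ge_min lexx.
rewrite div1r.
pose B n g := (eps%:E < `| ((max_degree n g)%:R / (ln (n%:R : R)))%:E
  - ((ln 2)^-1)%:E |)%E.
apply: (vanishing_cvg (B := B) hG).
apply: (vanishingU (vanishing_small_max e0 ec) (vanishing_large_max e0)).
near=> n; move=> g _; rewrite /B => {B}.
have n2 : (2 <= n)%N by near: n; exact: nbhs_infty_ge.
have Lp : 0 < ln (n%:R : R) by rewrite ln_gt0 // ltr1n.
rewrite lte_fin lter_normr => /orP[h|h]; apply/orP; [right|left].
  rewrite -ler_pdivlMr //; lra.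
rewrite -ltr_pdivrMr //; lra.
Unshelve. all: by end_near.
Qed.
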